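(* Let $\gamma$ be a strictly convex curve in $\mathbb{R}^2$. Then for every (continuous) line bundle $\mathscr{L}$ over $\gamma$ we have $\operatorname{int}(\Delta_* \mathscr{L}) \neq \varnothing$.
   Context: A strictly convex curve is understood in the usual sense: a plane curve which is the boundary of a bounded convex set with nonempty interior and which contains no nondegenerate line segment. No differentiability is assumed. A line bundle over $\gamma\subseteq\mathbb{R}^2$ means the embedded bundle $\mathscr{L}=\{(p,u)\in\gamma\times\mathbb{R}^2: u\in\varphi(p)\}$ defined by a continuous map $\varphi:\gamma\to\mathbb{P}^1=\operatorname{Gr}_1(2)$ into the space of lines through $0$ in $\mathbb{R}^2$. The codiagonal map is $\Delta_*(x,y)=x+y$, so $\Delta_*\mathscr{L}=\bigcup_{p\in\gamma}(p+\varphi(p))\subseteq\mathbb{R}^2$. $\operatorname{int}$ denotes interior in $\mathbb{R}^2$. *)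

(* Defs.v *)
From HB Require Import structures.
From mathcomp Require Import all_boot all_order all_algebra.
From mathcomp Require Import all_classical all_reals all_analysis.

Set Implicit Arguments.
Unset Strict Implicit.
Unset Printing Implicit Defensive.

Import Order.TTheory GRing.Theory Num.Theory.
Import numFieldNormedType.Exports.

Local Open Scope classical_set_scope.
Local Open Scope ring_scope.

Notation plane R := 'rV[R]_2.

Definition boundary (T : topologicalType) (A : set T) : set T :=
  closure A `\` interior A.

Definition segment (R : realType) (a b : plane R) : set (plane R) :=
  [set (1 - t) *: a + t *: b | t in `[0, 1]].

(* [K] need not be open or closed. *)
Definition strictly_convex_curve (R : realType) (gamma : set (plane R)) : Prop :=
  (exists K : set (plane R),
    [/\ convex_set K, bounded_set K, interior K !=set0 & gamma = boundary K]) /\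
  (forall a b : plane R, a != b -> ~ (segment a b `<=` gamma)).

Record projective_line (R : realType) := ProjectiveLine {
  line_vspace :> {vspace plane R};
  _ : \dim line_vspace == 1%N }.

Notation "'P1[' R ]" := (projective_line R) (format "'P1[' R ]").

HB.instance Definition _ (R : realType) := [isSub for @line_vspace R].
HB.instance Definition _ (R : realType) := [Choice of P1[R] by <:].

(* The quotient topology of the map [v |-> <[v]>] from the nonzero vectors onto
   the lines. The nonzero vectors are an open subset of the plane, so a subset
   of them is open for the subspace topology iff it is open in the plane. *)
Definition line_open (R : realType) (U : set P1[R]) : Prop :=
  open [set v : plane R | v != 0 /\ exists2 l : P1[R], U l & <[v]>%VS = l].

Section line_topology.
Variable R : realType.

Lemma line_openT : line_open [set: P1[R]].
Proof.
rewrite /line_open (_ : [set v | _] = ~` [set 0]); last first.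
  apply/seteqP; split => v /=; first by move=> [/eqP].
  move=> /eqP v0; split => //.
  have dv : \dim <[v]>%VS == 1%N by rewrite dim_vline v0.
  by exists (ProjectiveLine dv).
apply: closed_openC.
exact: accessible_closed_set1 (hausdorff_accessible (@norm_hausdorff _ _)) _.
Qed.

Lemma line_openI : setI_closed (@line_open R).
Proof.
move=> U V oU oV.
rewrite /line_open (_ : [set v | _] =
    [set v | v != 0 /\ exists2 l : P1[R], U l & <[v]>%VS = l] `&`
    [set v | v != 0 /\ exists2 l : P1[R], V l & <[v]>%VS = l]); first exact: openI.
apply/seteqP; split => v /=.
  by move=> [v0 [l [Ul Vl] vl]]; split; split => //; exists l.
move=> [[v0 [l Ul vl]] [_ [m Vm vm]]]; split => //; exists l => //; split => //.
by have -> : l = m by apply: val_inj; rewrite /= -vl -vm.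
Qed.

Lemma line_open_bigcup (I : Type) (f : I -> set P1[R]) :
  (forall i, line_open (f i)) -> line_open (\bigcup_i f i).
Proof.
move=> of_; rewrite /line_open (_ : [set v | _] = \bigcup_i
    [set v | v != 0 /\ exists2 l : P1[R], f i l & <[v]>%VS = l]).
  by apply: bigcup_open => i _; exact: of_.
apply/seteqP; split => v /=.
  by move=> [v0 [l [i _ fl] vl]]; exists i => //; split => //; exists l.
by move=> [i _ [v0 [l fl vl]]]; split => //; exists l => //; exists i.
Qed.

End line_topology.

HB.instance Definition _ (R : realType) :=
  isOpenTopological.Build P1[R] (@line_openT R) (@line_openI R)
    (@line_open_bigcup R).

(* [phi] is total; its values off [gamma] play no role. *)
Definition bundle_of (R : realType) (gamma : set (plane R))
    (phi : plane R -> P1[R]) : set (plane R * plane R) :=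
  [set pu : plane R * plane R | gamma pu.1 /\ pu.2 \in phi pu.1].

Definition line_bundle (R : realType) (gamma : set (plane R))
    (L : set (plane R * plane R)) : Prop :=
  exists2 phi : plane R -> P1[R],
    {within gamma, continuous phi} & L = bundle_of gamma phi.

Definition codiagonal (R : realType) (xy : plane R * plane R) : plane R :=
  xy.1 + xy.2.

(* Main.v *)
Require Import Defs.
From mathcomp Require Import all_boot all_order all_algebra.
From mathcomp Require Import all_classical all_reals all_analysis.
From mathcomp Require Import ring lra.
Import Order.TTheory GRing.Theory Num.Theory.
Import numFieldNormedType.Exports.

Set Implicit Arguments.
Unset Strict Implicit.
Unset Printing Implicit Defensive.

Local Open Scope classical_set_scope.
Local Open Scope ring_scope.

(** Only a small arc of the curve is used. Over an interval, the upper boundary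
    of the bounded convex set K is the graph of a bounded concave function f,
    hence a continuous path q s = (s, f s) in the curve
    (lemma [convex_boundary_graph]). On a shorter interval the lines phi (q s)
    admit normal vectors n s that depend continuously on s, because P1 is
    covered by charts consisting of the lines not orthogonal to a given
    direction (lemma [line_normal_continuous]).

    For a point x, the function s |-> <n s, x - q s> vanishes exactly when x is
    on the affine line q s + phi (q s). If it takes both signs, then so does the
    corresponding function for every point near x, and by the intermediate value
    theorem each of these points is on one of the lines: the union of the lines
    has an interior point. If it never takes both signs, whatever x is, then any
    two of the lines coincide, since a point crossing one line away from the
    other would see the product of two signs change
    (lemma [moving_line_sweep]). The whole arc is then on a single line, so it
    contains a segment, which strict convexity excludes. *)

(** * Coordinates in the plane *)

Section coordinates.
Variable R : realType.
Implicit Types u v : plane R.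

Definition point (a b : R) : plane R := a *: delta_mx 0 0 + b *: delta_mx 0 1.
Definition dotp u v : R := u 0 0 * v 0 0 + u 0 1 * v 0 1.
Definition perp u : plane R := point (- u 0 1) (u 0 0).

Lemma point0E a b : point a b 0 0 = a.
Proof. by rewrite !mxE /= mulr1 mulr0 addr0. Qed.

Lemma point1E a b : point a b 0 1 = b.
Proof. by rewrite !mxE /= mulr1 mulr0 add0r. Qed.

Lemma pointD a b a' b' : point a b + point a' b' = point (a + a') (b + b').
Proof. by rewrite /point addrACA -!scalerDl. Qed.

Lemma pointZ k a b : k *: point a b = point (k * a) (k * b).
Proof. by rewrite /point scalerDr !scalerA. Qed.

Lemma eq_plane u v : u 0 0 = v 0 0 -> u 0 1 = v 0 1 -> u = v.
Proof.
move=> uv0 uv1; apply/rowP => i.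
case: i => [[|[|//]] hi].
  by rewrite (_ : Ordinal hi = 0) //; apply: val_inj.
by rewrite (_ : Ordinal hi = 1) //; apply: val_inj.
Qed.

Lemma dotpp_gt0 u : u != 0 -> 0 < dotp u u.
Proof.
apply: contraNT; rewrite -leNgt /dotp => h; apply/eqP.
by apply: eq_plane; rewrite !mxE; nra.
Qed.

Lemma perp_neq0 u : u != 0 -> perp u != 0.
Proof.
apply: contra_neq => p0; apply: eq_plane.
  by rewrite -(point1E (- u 0 1) (u 0 0)) -/(perp u) p0 !mxE.
have := point0E (- u 0 1) (u 0 0); rewrite -/(perp u) p0 !mxE => h.
by apply: oppr_inj; rewrite oppr0.
Qed.

Lemma mem_vline_perp u v : u != 0 -> dotp (perp u) v = 0 -> v \in <[u]>%VS.
Proof.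
move=> u0; rewrite /dotp point0E point1E => h.
apply/vlineP; exists (dotp u v / dotp u u).
have u2 : dotp u u != 0 by rewrite gt_eqF ?dotpp_gt0.
have uv : u 0 0 * v 0 1 = u 0 1 * v 0 0 by lra.
rewrite /dotp in u2 *.
apply: eq_plane; rewrite !mxE; apply: (mulfI u2);
  rewrite mulrA mulrCA divff // mulr1.
  by ring: uv.
by ring: uv.
Qed.

Context (T : Type) (F : set_system T) {FF : Filter F}.

Lemma cvg_coord (p : T -> plane R) u j :
  p t @[t --> F] --> u -> p t 0 j @[t --> F] --> u 0 j.
Proof.
move=> pu; apply: (@cvg_comp _ _ _ p (fun v => v 0 j) _ _ _ pu).
exact: coord_continuous.
Qed.

Lemma cvg_point (f g : T -> R) a b : f t @[t --> F] --> a ->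
  g t @[t --> F] --> b -> point (f t) (g t) @[t --> F] --> point a b.
Proof. by move=> fa gb; apply: cvgD; exact: cvgZr_tmp. Qed.

Lemma cvg_dotp (p q : T -> plane R) u v : p t @[t --> F] --> u ->
  q t @[t --> F] --> v -> dotp (p t) (q t) @[t --> F] --> dotp u v.
Proof. by move=> pu qv; apply: cvgD; apply: cvgM; exact: cvg_coord. Qed.

End coordinates.

Lemma dotp_affine_continuous (R : realType) (u p y : plane R) :
  dotp u (z - p) @[z --> y] --> dotp u (y - p).
Proof.
have h : (fun z => z - p) z @[z --> nbhs y] --> y - p.
  by apply: (@cvgB _ _ _ (nbhs y)); [exact: cvg_id|exact: cvg_cst].
apply: (@cvg_dotp _ _ (nbhs y) _ (fun=> u) (fun z => z - p)) => //.
exact: cvg_cst.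
Qed.

(** * Moving lines *)

Lemma minmax_lt0M (R : realDomainType) (x y : R) :
  x * y < 0 -> Num.min x y <= 0 <= Num.max x y.
Proof.
rewrite ge_min le_max => xy.
by case: (lerP x 0) => ?; case: (lerP y 0) => ? /=; nra.
Qed.

Section sweep.
Variable R : realType.

(** The dichotomy behind the theorem, in contrapositive form: lines moving
    continuously cover an open set unless each of them contains all the base
    points. When the union has empty interior, the intermediate value theorem
    forces <n s, x - q s> and <n t, x - q t> to have a nonnegative product for
    every x. If q t were off the line at s, pushing x slightly off the line
    at t, to the appropriate side, would make the product negative. *)
Lemma moving_line_sweep (a b : R) (q n : R -> plane R) :
    {in `]a, b[, continuous q} -> {in `]a, b[, continuous n} ->
    {in `]a, b[, forall s, n s != 0} ->
    interior [set x | exists2 s, s \in `]a, b[ & dotp (n s) (x - q s) = 0] =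
      set0 ->
  {in `]a, b[ &, forall s t, dotp (n s) (q t - q s) = 0}.
Proof.
move=> cq cn n0 noint.
have mono (x : plane R) : {in `]a, b[ &, forall s t,
    0 <= dotp (n s) (x - q s) * dotp (n t) (x - q t)}.
  move=> s t; wlog st : s t / s <= t.
    move=> h sab tab; have [/h|/ltW/h] := leP s t; first exact.
    by rewrite mulrC; apply.
  move=> sab tab; rewrite leNgt; apply/negP => neg.
  pose P (y : plane R) := dotp (n s) (y - q s) * dotp (n t) (y - q t).
  have cP : continuous P.
    by move=> y; apply: (@cvgM _ _ (nbhs y)); exact: dotp_affine_continuous.
  suff : set0 x by [].
  rewrite -noint /interior.
  have Px : nbhs x [set y | P y < 0] := cP x _ (lt_nbhsl neg).
  apply: (filterS _ Px).
  move=> y /= Py.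
  pose g u := dotp (n u) (y - q u).
  have sub u : u \in `[s, t] -> u \in `]a, b[.
    by move: sab tab; rewrite !in_itv /= => *; lra.
  have cg : {within `[s, t], continuous g}.
    apply: continuous_in_subspaceT => u; rewrite inE /= => /sub uab.
    apply: cvg_dotp; first exact: cn.
    by apply: cvgB; [exact: cvg_cst|exact: cq].
  have := minmax_lt0M Py.
  by move=> /(IVT st cg)[u /sub uab gu]; exists u.
move=> {noint} s t sab tab; apply/eqP; apply: contraT => c0.
(* The push is - e times n t; the factor 1 / (1 + k ^ 2) in e makes it so small
   that the pairing with n s keeps the sign of c, as k < 1 + k ^ 2. *)
set c := dotp _ _ in c0; pose k := dotp (n s) (n t).
pose e := (1 + k ^+ 2)^-1 * c.
have := mono (q t - e *: n t) s t sab tab.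
have -> : dotp (n s) (q t - e *: n t - q s) = c - e * k.
  by rewrite /c /k /dotp !mxE; ring.
have -> : dotp (n t) (q t - e *: n t - q t) = - e * dotp (n t) (n t).
  by rewrite /dotp !mxE; ring.
have k1 : 0 < 1 + k ^+ 2 by rewrite ltr_pwDl ?sqr_ge0.
have -> : c - e * k = e * (1 + k ^+ 2 - k).
  by rewrite mulrBr; congr (_ - _); rewrite /e mulrAC mulVf ?mul1r ?gt_eqF.
rewrite leNgt => /negP[].
have -> : e * (1 + k ^+ 2 - k) * (- e * dotp (n t) (n t)) =
  - (e ^+ 2 * dotp (n t) (n t) * (1 + k ^+ 2 - k)) by ring.
have e2 : 0 < e ^+ 2.
  by rewrite exprn_even_gt0 //= mulf_neq0 ?invr_neq0 // gt_eqF.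
rewrite oppr_lt0; apply: mulr_gt0; last by nra.
by apply: mulr_gt0 => //; exact/dotpp_gt0/n0.
Qed.

End sweep.

(** * Continuous normals of lines *)

Section line_normal.
Variable R : realType.

(** Homogeneous of degree 0 in v, hence a function of the line spanned by v; up
    to a quarter turn, it rescales v to have pairing 1 with d. *)
Definition unit_pairing_normal (d v : plane R) := (dotp d v)^-1 *: perp v.

Definition line_normal (d : plane R) (l : P1[R]) :=
  unit_pairing_normal d (vpick l).

Definition transverse (d : plane R) : set P1[R] :=
  [set l | dotp d (vpick l) != 0].

Lemma vpick_line_neq0 (l : P1[R]) : vpick l != 0.
Proof.
rewrite vpick0; case: l => l /= dl; apply: contraTneq dl => ->.
by rewrite dimv0.
Qed.

Lemma lineE (l : P1[R]) : <[vpick l]>%VS = l.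
Proof.
apply/eqP; rewrite eqEdim -memvE memv_pick /= dim_vline vpick_line_neq0.
by case: l => l /= /eqP ->.
Qed.

Lemma line_ofP (v : plane R) : v != 0 -> exists l : P1[R], <[v]>%VS = l.
Proof.
move=> v0; have dv : \dim <[v]>%VS == 1%N by rewrite dim_vline v0.
by exists (ProjectiveLine dv).
Qed.

Lemma line_normal_neq0 d l : transverse d l -> line_normal d l != 0.
Proof.
move=> dl.
by rewrite scaler_eq0 invr_eq0 (negPf dl) /= perp_neq0 ?vpick_line_neq0.
Qed.

Lemma line_normal_mem d l u :
  transverse d l -> dotp (line_normal d l) u = 0 -> u \in line_vspace l.
Proof.
move=> dl h; rewrite -lineE; apply: mem_vline_perp (vpick_line_neq0 l) _.
have e : dotp (line_normal d l) u =
    (dotp d (vpick l))^-1 * dotp (perp (vpick l)) u.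
  rewrite /dotp /line_normal /unit_pairing_normal.
  by rewrite mxE [X in _ + X * _]mxE; ring.
move/eqP: h; rewrite e mulf_eq0 invr_eq0.
by rewrite (negPf (dl : _ != 0)) /= => /eqP.
Qed.

(** A set of lines is open when the nonzero vectors spanning them form an open
    set. As [unit_pairing_normal] is homogeneous, this set of vectors is given
    by the same formula with [vpick l] replaced by an arbitrary vector, on which
    the formula is continuous. *)
Lemma open_line_set (d : plane R) (O : set (plane R)) : open O ->
  open [set l | transverse d l /\ O (line_normal d l)].
Proof.
move=> oO.
have eqn (v : plane R) (l : P1[R]) : v != 0 -> <[v]>%VS = l ->
    (dotp d v != 0 <-> transverse d l) /\
    (dotp d v != 0 -> unit_pairing_normal d v = line_normal d l).
  move=> v0 vl; have : vpick l \in <[v]>%VS by rewrite vl memv_pick.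
  move=> /vlineP[k kE].
  have k0 : k != 0.
    by apply: contraNneq (vpick_line_neq0 l) => k0; rewrite kE k0 scale0r.
  have dE : dotp d (vpick l) = k * dotp d v.
    by rewrite kE /dotp !mxE; ring.
  rewrite /transverse /= dE mulf_eq0 negb_or k0; split=> // dv.
  rewrite /line_normal /unit_pairing_normal dE kE.
  have -> : perp (k *: v) = k *: perp v.
    by apply: eq_plane; rewrite [RHS]mxE !(point0E, point1E) !mxE; ring.
  by rewrite scalerA invfM mulrAC mulVf // mul1r.
suff : open [set v | dotp d v != 0 /\ O (unit_pairing_normal d v)].
  congr open; apply/seteqP; split => v /=.
    move=> [dv Ov].
    have v0 : v != 0.
      by apply: contraNneq dv => ->; rewrite /dotp !mxE !mulr0 addr0.
    have [l vl] := line_ofP v0; have [tr E] := eqn _ _ v0 vl.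
    by split => //; exists l => //; split; [exact/tr|rewrite -E].
  move=> [v0 [l [tl Ol] vl]]; have [tr E] := eqn _ _ v0 vl.
  by have dv := tr.2 tl; split => //; rewrite E.
rewrite openE => v /= [dv Ov].
have cdot : dotp d w @[w --> v] --> dotp d v.
  have := @dotp_affine_continuous _ d 0 v.
  by under eq_fun do rewrite subr0; rewrite subr0.
have cnorm : unit_pairing_normal d w @[w --> v] --> unit_pairing_normal d v.
  apply: (@cvgZ _ _ _ (nbhs v)); first exact: cvgV.
  apply: (@cvg_point _ _ (nbhs v)); last exact: coord_continuous.
  by apply: cvgN; exact: coord_continuous.
have nO := cnorm _ (open_nbhs_nbhs (conj oO Ov)).
have n0 := cdot _ (open_nbhs_nbhs (conj (@open_neq _ (0 : R)) dv)).
exact: (@filterI _ (nbhs v) _ _ _ n0 nO).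
Qed.

Lemma transverse_nbhs d l : transverse d l -> nbhs l (transverse d).
Proof.
move=> dl; have oT := open_line_set (d := d) (@openT (plane R)).
by apply: filterS (open_nbhs_nbhs (conj oT (conj dl I))) => ? [].
Qed.

Lemma line_normal_continuous d l :
  transverse d l -> {for l, continuous (line_normal d)}.
Proof.
move=> dl A; rewrite nbhsE => -[W [oW Wl] WA].
have oT := open_line_set (d := d) oW.
by apply: filterS (open_nbhs_nbhs (conj oT (conj dl Wl))) => ? [_ /WA].
Qed.

End line_normal.

(** * The upper boundary of a convex set *)

Section concave.
Variable R : realType.

(** Concavity bounds the drop of f from x to y by extending the segment past y
    by a fixed amount w: f cannot lose more than the share |y - x| / w of its
    total oscillation M - m. Exchanging x and y gives a Lipschitz bound. *)
Lemma bounded_concave_continuous (f : R -> R) (a b m M : R) :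
    {in `]a, b[, forall s, m <= f s <= M} ->
    {in `]a, b[ &, forall s t, forall k : R, 0 <= k <= 1 ->
      (1 - k) * f s + k * f t <= f ((1 - k) * s + k * t)} ->
  {in `]a, b[, continuous f}.
Proof.
move=> fmM fcc s sab.
have mM : 0 <= M - m by have := fmM _ sab; lra.
have drop (w x y : R) : 0 < w -> x != y -> `|y - x| <= w -> x \in `]a, b[ ->
    x + (y - x) / `|y - x| * w \in `]a, b[ ->
    f x - f y <= `|y - x| / w * (M - m).
  move=> w0 xy yxw xab zab; set z := x + _ in zab.
  have d0 : 0 < `|y - x| by rewrite normr_gt0 subr_eq0 eq_sym.
  have k01 : 0 <= `|y - x| / w <= 1.
    by rewrite ler_pdivrMr // mul1r yxw andbT divr_ge0 // ltW.
  have := fcc _ _ xab zab _ k01.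
  have -> : (1 - `|y - x| / w) * x + `|y - x| / w * z = y.
    by rewrite /z; field; rewrite !gt_eqF.
  have := fmM _ xab; have := fmM _ zab; move: (`|y - x| / w) k01 => k; nra.
(* The half leaves room for a move of length w starting at any t near s. *)
pose w := Num.min (s - a) (b - s) / 2.
have [wa wb] : w * 2 <= s - a /\ w * 2 <= b - s.
  by rewrite /w divfK ?pnatr_eq0 // !ge_min !lexx orbT.
have w0 : 0 < w.
  by rewrite divr_gt0 // lt_min !subr_gt0; move: sab; rewrite in_itv.
move: w w0 wa wb => w w0 wa wb.
apply/(@cvgrPdist_le _ R^o) => e e0; near=> t.
have [<-|st] := eqVneq s t; first by rewrite subrr normr0 ltW.
have tsw : `|t - s| < w.
  by rewrite distrC; near: t; apply: (@cvgr_dist_lt _ R^o _ _ _ id).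
have tse : `|t - s| < w * e / (M - m + 1).
  rewrite distrC; near: t; apply: (@cvgr_dist_lt _ R^o _ _ _ id) => //.
  by apply: divr_gt0; [exact: mulr_gt0|lra].
have dw (x y : R) : x != y -> `|(y - x) / `|y - x| * w| <= w.
  move=> xy; have yx : `|y - x| != 0 by rewrite normr_eq0 subr_eq0 eq_sym.
  by rewrite !normrM normfV normr_id divff // mul1r (gtr0_norm w0).
have near_s (x : R) : `|x - s| < w * 2 -> x \in `]a, b[.
  by rewrite in_itv /= ltr_norml; lra.
have tab : t \in `]a, b[ by apply: near_s; lra.
have fst : f s - f t <= `|t - s| / w * (M - m).
  apply: (drop w s t w0 st (ltW tsw) sab).
  by apply: near_s; rewrite [s + _]addrC addrK; have := dw _ _ st; lra.
have fts : f t - f s <= `|t - s| / w * (M - m).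
  rewrite distrC in tsw; rewrite eq_sym in st.
  rewrite (distrC t s); apply: (drop w t s w0 st (ltW tsw) tab).
  apply: near_s; rewrite addrAC; apply: le_lt_trans (ler_normD _ _) _.
  by rewrite distrC in tsw; have := dw _ _ st; lra.
have : `|t - s| / w * (M - m) <= e.
  have mM1 : 0 < M - m + 1 by lra.
  move: tse; rewrite ltr_pdivlMr // => tse.
  by rewrite mulrAC ler_pdivrMr //; have := normr_ge0 (t - s); lra.
by rewrite ler_norml; lra.
Unshelve. all: by end_near. Qed.

End concave.

Section upper_graph.
Variable R : realType.

Lemma ler_coord_norm (v : plane R) j : `|v 0 j| <= `|v|.
Proof.
rewrite [leRHS]/Num.norm /= mx_normrE.
by apply/bigmax_geP; right; exists (0, j).
Qed.

Definition fiber (K : set (plane R)) s : set R := [set t | K (point s t)].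

(** The function is the supremum of the vertical fibers of K, above an interval
    of abscissas around that of an interior point c, on which the fibers contain
    the ordinate of c. *)
Lemma convex_boundary_graph (K : set (plane R)) :
    convex_set K -> bounded_set K -> interior K !=set0 ->
  exists a b (f : R -> R), [/\ a < b, {in `]a, b[, continuous f} &
    {in `]a, b[, forall s, boundary K (point s (f s))}].
Proof.
move=> cK /ex_strict_bound_gt0[M M0 KM] [c Kc].
have segK x y k : K x -> K y -> 0 <= k <= 1 -> K ((1 - k) *: x + k *: y).
  move=> Kx Ky /andP[k0 k1].
  have kP : Itv.spec (@Itv.num_sem R) (Itv.Real `[0%Z, 1%Z]) k.
    by rewrite /Itv.num_sem /= num_real in_itv /= k0 k1.
  have := cK y x (Itv.mk kP) _ _; rewrite !inE => /(_ Ky Kx).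
  by rewrite addrC.
have [r r0 Kr] : exists2 r : R, 0 < r & forall s, c 0 0 - r < s < c 0 0 + r ->
    K (point s (c 0 1)).
  have cE : point (c 0 0) (c 0 1) = c.
    by apply: eq_plane; rewrite ?point0E ?point1E.
  have cvg_pt : point s (c 0 1) @[s --> c 0 0] --> point (c 0 0) (c 0 1).
    by apply: cvg_point; [exact: cvg_id|exact: cvg_cst].
  have : interior K (point (c 0 0) (c 0 1)) by rewrite cE.
  move=> /cvg_pt/nbhs_ballP[r /= r0 br].
  exists r => // s sr; apply: br.
  by rewrite /ball /= ltr_norml; lra.
pose f s := sup (fiber K s); pose a := c 0 0 - r; pose b := c 0 0 + r.
have leM s t : K (point s t) -> t <= M.
  move=> /KM/ltW; apply: le_trans; have := ler_coord_norm (point s t) 1.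
  by rewrite point1E; exact: le_trans (ler_norm t).
have hs s : s \in `]a, b[ -> has_sup (fiber K s).
  rewrite in_itv /= => /Kr Ks; split; first by exists (c 0 1).
  by exists M => u /leM.
have le_f s t : K (point s t) -> t <= f s.
  by move=> Kst; apply: ub_le_sup => //; exists M => u /leM.
have adh s e : s \in `]a, b[ -> 0 < e ->
    exists t, [/\ K (point s t), f s - e < t & t <= f s].
  move=> /hs fs e0; have [t Kst et] := sup_adherent e0 fs.
  by exists t; split => //; exact: le_f.
exists a, b, f; split.
- by rewrite /a /b; lra.
- apply: (@bounded_concave_continuous _ f a b (c 0 1) M).
    move=> s sab; apply/andP; split.
      by apply/le_f/Kr; move: sab; rewrite in_itv.
    apply: ge_sup; first by have [] := hs _ sab.
    by move=> u /leM.
  move=> s t sab tab k k01; apply/ler_addgt0Pr => e e0.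
  have [u [Ku eu _]] := adh s e sab e0; have [v [Kv ev _]] := adh t e tab e0.
  have : (1 - k) * u + k * v <= f ((1 - k) * s + k * t).
    apply: le_f.
    rewrite (_ : point _ _ = (1 - k) *: point s u + k *: point t v).
      exact: segK.
    by rewrite !pointZ pointD.
  by move/andP: k01 => [k0 k1]; nra.
- move=> s sab.
  have cvg_pt : point s t @[t --> f s] --> point s (f s).
    by apply: cvg_point; [exact: cvg_cst|exact: cvg_id].
  split.
    (* Points of K just below the supremum are close to the graph. *)
    move=> B /cvg_pt/nbhs_ballP[e /= e0 Be].
    have [t [Kt et tf]] := adh s e sab e0.
    exists (point s t); split => //; apply: Be.
    by rewrite /ball /= ltr_norml; lra.
  (* A neighborhood in K would contain points above the supremum. *)
  move=> /cvg_pt/nbhs_ballP[e /= e0 Be].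
  have := le_f s (f s + e / 2); rewrite leNgt => /(_ (Be _ _))/negP; apply.
    by rewrite /ball /= ltr_norml; lra.
  by lra.
Qed.

End upper_graph.

(** * The theorem *)

Theorem theorem5p2p3 (R : realType) (gamma : set (plane R))
  (hgamma : strictly_convex_curve gamma)
  (L : set (plane R * plane R)) (hL : line_bundle gamma L) :
  interior (@codiagonal R @` L) !=set0.
Proof.
case: hgamma => -[K [cK bK iK gK]] noseg.
case: hL => phi /subspace_continuousP cphi LE.
have [a [b [f [ab cf fK]]]] := convex_boundary_graph cK bK iK.
pose q s := point s (f s).
have cq : {in `]a, b[, continuous q}.
  by move=> s sab; apply: cvg_point; [exact: cvg_id|exact: cf].
have qg s : s \in `]a, b[ -> gamma (q s) by rewrite gK; exact: fK.
have nbhs_ab s : s \in `]a, b[ -> nbhs s [set t | t \in `]a, b[].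
  by move=> sab; apply: open_nbhs_nbhs; split => //; exact: itv_open.
have cphiq : {in `]a, b[, continuous (phi \o q)}.
  move=> s sab; apply: cvg_comp (cphi _ (qg _ sab)).
  move=> A wA.
  have nA : nbhs s [set t | gamma (q t) -> A (q t)] := cq _ sab _ wA.
  by apply: filterS2 (nbhs_ab _ sab) nA => t tab; apply; exact: qg.
pose s0 := (a + b) / 2.
have s0ab : s0 \in `]a, b[ by rewrite in_itv /= /s0; lra.
(* The chart of lines not orthogonal to the line at the middle of the arc. *)
pose d := vpick (phi (q s0)).
have td : transverse d (phi (q s0)).
  by rewrite /transverse /= gt_eqF // dotpp_gt0 // vpick_line_neq0.
have [r r0 tr] : exists2 r : R, 0 < r & forall s, s0 - r < s < s0 + r ->
    (s \in `]a, b[) /\ transverse d (phi (q s)).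
  have := cphiq _ s0ab _ (transverse_nbhs td).
  move=> /(filterI (nbhs_ab _ s0ab))/nbhs_ballP[r /= r0 br].
  by exists r => // s sr; apply: br; rewrite /ball /= ltr_norml; lra.
pose n s := line_normal d (phi (q s)).
have J s : s \in `]s0 - r, s0 + r[ ->
    (s \in `]a, b[) /\ transverse d (phi (q s)).
  by rewrite in_itv => /tr.
apply: contrapT => /set0P/negP; rewrite negbK => /eqP int0.
have col : {in `]s0 - r, s0 + r[ &, forall s t, dotp (n s) (q t - q s) = 0}.
  apply: moving_line_sweep.
  - by move=> s /J[sab _]; exact: cq.
  - move=> s /J[sab ts]; apply: (@cvg_comp _ _ _ (phi \o q) (line_normal d)).
      exact: cphiq.
    exact: line_normal_continuous.
  - by move=> s /J[_ ts]; exact: line_normal_neq0.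
  rewrite -subset0 -int0; apply: interiorS => x [s /J[sab ts] nx].
  exists (q s, x - q s) => /=; last by rewrite /codiagonal /= addrC subrK.
  by rewrite LE; split; [exact: qg|exact: line_normal_mem nx].
pose t0 := s0 + r / 2.
have J0 : s0 \in `]s0 - r, s0 + r[ by rewrite in_itv /=; lra.
have J1 : t0 \in `]s0 - r, s0 + r[ by rewrite in_itv /= /t0; lra.
have n0 : n s0 != 0 by apply: line_normal_neq0.
have dq t : dotp (n s0) (q t - q s0) =
    n s0 0 0 * (t - s0) + n s0 0 1 * (f t - f s0).
  by rewrite -scaleN1r pointZ pointD /dotp point0E point1E !mulN1r.
(* The line that carries the arc is not vertical, as the arc is a graph. *)
have n1 : n s0 0 1 != 0.
  apply: contraNneq n0 => n1; apply/eqP/eq_plane; rewrite [RHS]mxE //.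
  have := col _ _ J0 J1; rewrite dq n1 mul0r addr0.
  have -> : t0 - s0 = r / 2 by rewrite /t0; ring.
  move/eqP; rewrite mulf_eq0 (gt_eqF (divr_gt0 r0 (ltr0Sn _ 1))) orbF.
  by move/eqP.
apply: (noseg (q s0) (q t0)).
  apply/eqP => /(congr1 (fun v : plane R => v 0 0)); rewrite !point0E /t0; lra.
move=> _ [k + <-]; rewrite /= in_itv /= => k01.
pose u := (1 - k) * s0 + k * t0.
have Ju : u \in `]s0 - r, s0 + r[ by rewrite in_itv /= /u /t0; nra.
rewrite (_ : _ + _ = q u); first exact/qg/(J u Ju).1.
rewrite !pointZ pointD; congr point.
have := col _ _ J0 Ju; have := col _ _ J0 J1; rewrite !dq => h1 h2.
apply: (mulfI n1); rewrite /u in h2 *; move: h1 h2; move: (f _) => fu; nra.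
Qed.
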